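(* If $c$ is real with $0\le c\le 1/4$, then $r_{\mathrm{bif}}(c)=1/4-c$.
   Context: $f_c(z)=z^2+c$, extended to $\widehat{\mathbb{C}}$ by $f_c(\infty)=\infty$. For $c\in\mathbb{C}$, $r\ge0$, $G_{c,r}$ is the semigroup under composition generated by $\{f_{c'}:|c'-c|\le r\}$. A minimal set of a polynomial semigroup $G$ is a minimal element, with respect to inclusion, of the family of non-empty compact $L\subset\widehat{\mathbb{C}}$ with $g(L)\subset L$ for all $g\in G$; it is planar if $\infty\notin L$. The bifurcation radius $r_{\mathrm{bif}}(c)$ is the supremum of those $r\ge0$ for which $G_{c,r}$ has a planar minimal set (equivalently the infimum of those $r\ge0$ for which $G_{c,r}$ has no planar minimal set); by prior work this value is attained and $G_{c,r}$ has a planar minimal set iff $r\le r_{\mathrm{bif}}(c)$. *)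

(* Defs.v *)
From HB Require Import structures.
From mathcomp Require Import all_boot all_order all_algebra.
From mathcomp Require Import all_classical all_reals all_analysis.
From mathcomp Require Import complex.
Set Implicit Arguments. Unset Strict Implicit. Unset Printing Implicit Defensive.
Import Order.TTheory GRing.Theory Num.Theory.
Import numFieldTopology.Exports.
Local Open Scope classical_set_scope.
Local Open Scope ring_scope.
Local Open Scope complex_scope.

(* The complex plane C = R[i] with its norm topology, and the Riemann sphere
   as its one-point compactification (None = infinity). *)
Definition Csphere (R : realType) := one_point_compactification (R[i])^o.

Definition fquad (R : realType) (c : R[i]) (z : Csphere R) : Csphere R :=
  match z with
  | Some w => Some (w ^+ 2 + c : (R[i])^o)
  | None => None
  end.

Inductive Gsemi (R : realType) (c : R[i]) (r : R) :
    (Csphere R -> Csphere R) -> Prop :=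
  | Gsemi_gen (c' : R[i]) : `|c' - c| <= r%:C -> Gsemi c r (fquad c')
  | Gsemi_comp g h : Gsemi c r g -> Gsemi c r h -> Gsemi c r (g \o h).

Definition invariant_compact (R : realType)
    (G : (Csphere R -> Csphere R) -> Prop) (L : set (Csphere R)) : Prop :=
  L !=set0 /\ compact L /\ (forall g, G g -> g @` L `<=` L).

Definition minimal_set (R : realType)
    (G : (Csphere R -> Csphere R) -> Prop) (L : set (Csphere R)) : Prop :=
  invariant_compact G L /\
  (forall L', invariant_compact G L' -> L' `<=` L -> L' = L).

Definition planar_minimal_set (R : realType)
    (G : (Csphere R -> Csphere R) -> Prop) (L : set (Csphere R)) : Prop :=
  minimal_set G L /\ ~ L None.

Definition rbif (R : realType) (c : R[i]) : R :=
  sup [set r : R | 0 <= r /\ exists L, planar_minimal_set (Gsemi c r) L].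

(* Main.v *)
Require Import Defs.
From HB Require Import structures.
From mathcomp Require Import all_boot all_order all_algebra.
From mathcomp Require Import all_classical all_reals all_analysis.
From mathcomp Require Import complex ring lra.
Import Order.TTheory GRing.Theory Num.Theory.
Import numFieldTopology.Exports.
Local Open Scope classical_set_scope.
Local Open Scope ring_scope.
Local Open Scope complex_scope.

Set Implicit Arguments.
Unset Strict Implicit.
Unset Printing Implicit Defensive.

(** If [x + r <= 1/4], the disc [|z| <= 1/2] is invariant, and Zorn's lemma
    yields a minimal set inside it.  Let [x + r > 1/4] and let [A] be a bounded
    invariant subset of the plane.  A real point of [A] would escape to infinity
    under [t |-> t ^ 2 + x + r].  A point of the disc [|z| <= 1/2] can be steered
    to the real line, so [A] avoids this disc, on the complement of which
    squaring is expanding: if [A] contains the ball of centre [w] and radius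
    [rho], the squares of its points cover the ball of centre [w ^ 2] and radius
    [rho], hence [A] contains the ball of centre [w ^ 2 + x] and radius
    [rho + r].  The radii being unbounded, [A] is empty. *)

(** * The modulus on the complex plane *)

Local Notation normc := Normc.normc.

Lemma sqr_normcE (R : rcfType) (z : R[i]) :
  normc z ^+ 2 = complex.Re z ^+ 2 + complex.Im z ^+ 2.
Proof. by case: z => a b /=; rewrite sqr_sqrtr// addr_ge0// sqr_ge0. Qed.

Lemma normc_ge0 (R : rcfType) (z : R[i]) : 0 <= normc z.
Proof. by case: z => a b; exact: sqrtr_ge0. Qed.

Lemma normc_Re_ge (R : rcfType) (z : R[i]) : `|complex.Re z| <= normc z.
Proof. by have := normc_ge_Re z; rewrite lecR. Qed.

Lemma normc_real (R : rcfType) (t : R) : normc t%:C = `|t|.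
Proof. by rewrite /= expr0n addr0 sqrtr_sqr. Qed.

Lemma normc_imaginary (R : rcfType) (t : R) : normc (0 +i* t) = `|t|.
Proof. by rewrite /= expr0n add0r sqrtr_sqr. Qed.

Lemma normcB (R : rcfType) (y z : R[i]) : normc (y - z) = normc (z - y).
Proof. by rewrite -opprB; exact: (@normcN R). Qed.

(** * Bounded sets stable under all parameters of a disc *)

Lemma real_natmul_unbounded (R : realType) (d M : R) : 0 < d ->
  exists n : nat, M < n%:R * d.
Proof.
move=> d0; exists (Num.bound `|M / d|).
rewrite -ltr_pdivrMr//; apply: le_lt_trans (ler_norm _) _.
exact: archi_boundP.
Qed.

Definition disc_stable (R : realType) (x r : R) (A : set R[i]) :=
  forall z c : R[i], A z -> normc (c - x%:C) <= r -> A (z ^+ 2 + c).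

Lemma no_real_point (R : realType) (x r M : R) (A : set R[i]) (t : R) :
  0 <= r -> 1 / 4 < x + r -> (forall z, A z -> normc z <= M) ->
  disc_stable x r A -> ~ A t%:C.
Proof.
move=> r0 xr Abnd Ainv At; have [d dE] : exists d, d = x + r - 1 / 4 by eexists.
have d0 : 0 < d by lra.
have grow n : exists2 s : R, A s%:C & t + n%:R * d <= s.
  elim: n => [|n [s As ts]]; first by exists t; rewrite // mul0r addr0.
  exists (s ^+ 2 + (x + r)).
    rewrite rmorphD rmorphXn/=; apply: Ainv => //.
    by rewrite -rmorphB (addrC x) addrK normc_real ger0_norm.
  (* Here s^2 + (x + r) - s = (s - 1/2)^2 + [d], so each step gains at least [d]. *)
  by rewrite -natr1 mulrDl mul1r; have := sqr_ge0 (s - 1 / 2); nra.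
have [n Mn] := real_natmul_unbounded (M - t) d0.
have [s As ts] := grow n.
have := Abnd _ As; rewrite normc_real => sM.
by have := ler_norm s; lra.
Qed.

(* The parameter x -/+ i r lowers |Im z| by r at each step, because
   |Im (z ^ 2)| = 2 |Re z| |Im z| <= |Im z|; the orbit thus reaches the reals. *)
Lemma no_point_in_strip (R : realType) (x r M : R) (A : set R[i]) (a b : R) :
  0 <= x <= 1 / 4 -> 1 / 4 < x + r -> (forall z, A z -> normc z <= M) ->
  disc_stable x r A ->
  `|a| <= 1 / 2 -> b ^+ 2 <= 1 / 2 -> ~ A (a +i* b).
Proof.
move=> /andP[x0 x14] xr Abnd Ainv.
have r_gt0 : 0 < r by lra.
have [n bn] := real_natmul_unbounded `|b| r_gt0.
elim: n a b bn => [|n IH] a b bn ha hb Az.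
  by have := normr_ge0 b; rewrite mul0r in bn; lra.
have step (s : R) : `|s| <= r -> A ((a ^+ 2 - b ^+ 2 + x) +i* (2 * a * b + s)).
  move=> sr; have := Ainv _ (x +i* s) Az.
  have -> : (a +i* b) ^+ 2 + (x +i* s) =
      (a ^+ 2 - b ^+ 2 + x) +i* (2 * a * b + s).
    by rewrite expr2; simpc; congr (_ +i* _); ring.
  have -> : x +i* s - x%:C = 0 +i* s.
    by apply/eqP; rewrite eq_complex /= subrr subr0 !eqxx.
  by rewrite normc_imaginary; exact.
have vb : `|2 * a * b| <= `|b|.
  rewrite !normrM (ger0_norm (ler0n _ 2)).
  by have := normr_ge0 b; nra.
have a2 : a ^+ 2 <= 1 / 4.
  by rewrite -real_normK ?num_real//; have := normr_ge0 a; nra.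
have a20 := sqr_ge0 a; have b20 := sqr_ge0 b.
(* The new real part lies between -b^2 and a^2 + x: the bound on b^2 is what keeps it above -1/2. *)
have ha' : `|a ^+ 2 - b ^+ 2 + x| <= 1 / 2 by rewrite ler_norml; lra.
(* If |2ab| <= r, one parameter cancels the imaginary part; otherwise [s] shortens it by exactly
   [r]. *)
have [vr|vr] := leP `|2 * a * b| r.
  have := step (- (2 * a * b)); rewrite normrN subrr => /(_ vr).
  by apply: (no_real_point (x := x) (r := r) (M := M)) => //; exact: ltW.
pose s := - (Num.sg (2 * a * b) * r).
have v0 : 2 * a * b != 0 by rewrite -normr_gt0; lra.
have sr : `|s| <= r by rewrite normrN normrM normr_sg v0 mul1r gtr0_norm.
have vs : `|2 * a * b + s| = `|2 * a * b| - r.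
  rewrite /s {1}[2 * a * b]numEsg -mulrBr normrM normr_sg v0 mul1r.
  by rewrite ger0_norm// subr_ge0 ltW.
apply: (IH _ _ _ ha' _ (step s sr)).
  by rewrite vs; move: bn; rewrite -natr1 mulrDl mul1r; lra.
apply: le_trans hb; rewrite -(real_normK (num_real b)).
rewrite -[leLHS](real_normK (num_real _)).
by apply: lerXn2r; rewrite ?nnegrE// vs; lra.
Qed.

(** Otherwise the ball would meet the disc |z| <= 1/2, all of whose points are excluded by
    [no_point_in_strip]. *)
Lemma ball_center_far (R : realType) (x r M : R) (A : set R[i])
    (w : R[i]) (rho : R) :
  0 <= x <= 1 / 4 -> 1 / 4 < x + r -> (forall z, A z -> normc z <= M) ->
  disc_stable x r A -> 0 <= rho ->
  (forall z, normc (z - w) <= rho -> A z) -> 1 / 2 + rho < normc w.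
Proof.
move=> x014 xr Abnd Ainv rho0 Aw; rewrite ltNge; apply/negP => w_le.
have d0 : 0 < 1 / 2 + rho by lra.
(* Shrinking [w] by this factor gives both |k w| <= 1/2 and (1 - k)|w| <= [rho], because |w| <= 1/2
   + [rho]. *)
pose k := 1 / 2 / (1 / 2 + rho).
have k1 : 1 - k = rho / (1 / 2 + rho) by rewrite /k; field; lra.
pose y := k%:C * w.
have yw : normc (y - w) <= rho.
  rewrite normcB /y -{1}[w]mul1r -mulrBl Normc.normcM -(rmorphB _ 1 k).
  rewrite normc_real k1 ger0_norm ?divr_ge0 ?(ltW d0)// -mulrA ler_piMr// ler_pdivrMl//.
  by rewrite mulr1.
have y12 : normc y <= 1 / 2.
  rewrite /y Normc.normcM normc_real ger0_norm; last first.
    by rewrite /k divr_ge0//; lra.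
  by rewrite /k mulrAC ler_pdivrMr// ler_pM2l//; lra.
have y2 := sqr_normcE y.
have {}y12 : normc y ^+ 2 <= 1 / 4 by have := normc_ge0 y; nra.
have := Aw _ yw; case: y y2 y12 {yw} => a b.
rewrite [X in _ = X]/= => -> ab; apply: (no_point_in_strip (x := x) (r := r) (M := M)) => //.
  rewrite ler_norml; have := sqr_ge0 b; nra.
by have := sqr_ge0 a; nra.
Qed.

(** For a square root z of w^2 + eta, the distances from z to w and to -w have product |eta| <= rho
    and sum at least 2|w| >= 1 + rho. This forces the smaller one to be at most rho. *)
Lemma square_ball_cover (R : rcfType) (w eta : R[i]) (rho : R) :
  (1 + rho) / 2 <= normc w -> normc eta <= rho ->
  exists2 z, normc (z - w) <= rho & z ^+ 2 = w ^+ 2 + eta.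
Proof.
move=> hw heta.
(* Of the two opposite roots, take the one nearer to [w]. *)
have [z zE pq] : exists2 z, z ^+ 2 = w ^+ 2 + eta &
    normc (z - w) <= normc (z + w).
  pose z := sqrtc (w ^+ 2 + eta).
  have [h|h] := leP (normc (z - w)) (normc (z + w)).
    by exists z; rewrite ?sqr_sqrtc.
  exists (- z); first by rewrite sqrrN sqr_sqrtc.
  rewrite -opprD (_ : - z + w = - (z - w)); last by rewrite opprB addrC.
  by rewrite (normcN (z + w : Rcomplex R)) (normcN (z - w : Rcomplex R)) ltW.
exists z => //; rewrite leNgt; apply/negP => p_gt.
have prod_le : normc (z - w) * normc (z + w) <= rho.
  by rewrite -Normc.normcM -subr_sqr zE addrAC subrr add0r.
have sum_ge : 2 * normc w <= normc (z - w) + normc (z + w).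
  rewrite (normcB z w) addrC; apply: le_trans (le_normcD (z + w) (w - z)).
  have -> : z + w + (w - z) = w *+ 2 by rewrite mulr2n; ring.
  by rewrite normcMn mulr_natl.
have p0 := normc_ge0 (z - w).
(* p = |z - w| and q = |z + w| satisfy p q <= rho and 1 + rho <= p + q,
   whence (1 - p) (1 - q) <= 0. *)
have [q1|q1] := leP 1 (normc (z + w)).
  by have := ler_peMr p0 q1; lra.
have : 0 < (1 - normc (z - w)) * (1 - normc (z + w)) by apply: mulr_gt0; lra.
by lra.
Qed.

Lemma growing_balls (R : realType) (x r M : R) (A : set R[i]) (n : nat) :
  0 <= x <= 1 / 4 -> 1 / 4 < x + r -> (forall z, A z -> normc z <= M) ->
  disc_stable x r A -> (exists z, A z) ->
  exists w, forall z, normc (z - w) <= n%:R * r -> A z.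
Proof.
move=> x014 xr Abnd Ainv [z0 Az0]; elim: n => [|n [w Bw]].
  exists z0 => z; rewrite mul0r => h.
  suff /Normc.eq0_normc /eqP : normc (z - z0) = 0 by rewrite subr_eq0 => /eqP ->.
  by apply/eqP; rewrite eq_le h normc_ge0.
have r_gt0 : 0 < r by lra.
have nr0 : 0 <= n%:R * r by rewrite mulr_ge0// ltW.
have wfar := ball_center_far x014 xr Abnd Ainv nr0 Bw.
exists (w ^+ 2 + x%:C) => z; rewrite -natr1 mulrDl mul1r => hz.
(* Split the displacement z - (w^2 + x) = (1-k) u + k u between the two radii. *)
pose u := z - (w ^+ 2 + x%:C).
have [k [k0 k1 [ku k'u]]] : exists k, [/\ 0 <= k, k <= 1 &
    k * normc u <= n%:R * r /\ (1 - k) * normc u <= r].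
  have d0 : 0 < n%:R * r + r by lra.
  exists (n%:R * r / (n%:R * r + r)).
  have e : 1 - n%:R * r / (n%:R * r + r) = r / (n%:R * r + r).
    by field; lra.
  have e1 : n%:R * r / (n%:R * r + r) = 1 - r / (n%:R * r + r).
    by field; lra.
  have q : normc u / (n%:R * r + r) <= 1 by rewrite ler_pdivrMr// mul1r.
  have t0 : 0 <= r / (n%:R * r + r) by rewrite divr_ge0// ltW.
  split.
  - by rewrite divr_ge0// ltW.
  - by rewrite e1; lra.
  - split; first by rewrite mulrAC -mulrA ler_piMr.
    by rewrite e mulrAC -mulrA ler_piMr// ltW.
have [z1 z1w z1E] : exists2 z1, normc (z1 - w) <= n%:R * r &
    z1 ^+ 2 = w ^+ 2 + k%:C * u.
  (* By [wfar], |w| > 1/2 + n r >= (1 + n r) / 2. *)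
  apply: square_ball_cover; first by lra.
  by rewrite Normc.normcM normc_real ger0_norm.
have -> : z = z1 ^+ 2 + (x%:C + (1 - k)%:C * u).
  by rewrite z1E /u rmorphB rmorph1; ring.
apply: Ainv; first exact: Bw.
rewrite addrAC subrr add0r Normc.normcM normc_real ger0_norm//; lra.
Qed.

Lemma bounded_stable_empty (R : realType) (x r M : R) (A : set R[i]) z :
  0 <= x <= 1 / 4 -> 1 / 4 < x + r -> (forall z, A z -> normc z <= M) ->
  disc_stable x r A -> ~ A z.
Proof.
move=> x014 xr Abnd Ainv Az; have r_gt0 : 0 < r by lra.
have [n Mn] := real_natmul_unbounded M r_gt0.
have [w Bw] := growing_balls n x014 xr Abnd Ainv (ex_intro _ z Az).
have nr0 : 0 <= n%:R * r by rewrite mulr_ge0// ltW.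
have wfar := ball_center_far x014 xr Abnd Ainv nr0 Bw.
have /Abnd : A w by apply: Bw; rewrite subrr Normc.normc0.
lra.
Qed.

(** * Compactness and existence of minimal sets *)

Lemma compact_image_some (X : topologicalType) (A : set X) :
  @compact (one_point_compactification X) (Some @` A) <-> compact A.
Proof.
split=> [cA F PF FA|cA]; last first.
  apply: continuous_compact cA.
  apply: continuous_subspaceT.
  exact: one_point_compactification_some_continuous.
have FSome B : F B -> (Some @ F) (Some @` B).
  move=> FB; rewrite /fmap/=.
  by apply: filterS FB => y By; exists y.
have [_ [[p Ap <-] clp]] := cA (Some @ F) _ (FSome A FA).
exists p; split => // B V FB pV.
have [_ [[b Bb <-] [v Vv [vb]]]] :=
  clp _ _ (FSome B FB) (one_point_compactification_some_nbhs _ _ pV).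
by exists b; split; rewrite // -vb.
Qed.

Lemma cluster_sub_closure (X : topologicalType) (F : set_system X) (A : set X) :
  F A -> cluster F `<=` closure A.
Proof. by move=> FA p clp V pV; exact: clp. Qed.

(** Zorn's lemma for unions is applied to the sets removed from [K]: a maximal removed set leaves a
    minimal invariant compact set. *)
Lemma exists_minimal_invariant_compact (X : topologicalType)
    (G : (X -> X) -> Prop) (K : set X) :
  let inv L := [/\ L !=set0, compact L & forall g, G g -> g @` L `<=` L] in
  hausdorff_space X -> inv K ->
  exists2 L, L `<=` K /\ inv L & forall L', inv L' -> L' `<=` L -> L' = L.
Proof.
move=> inv hX [K0 cK gK].
have [F FP Ftot|U [[U0 cU gU] Umax]] :=
    @Zorn_bigcup X [set U | inv (K `\` U)]; last first.
  exists (K `\` U); first by split => // z [].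
  move=> L' [L'0 cL' gL'] L'U; apply/seteqP; split=> // z [Kz Uz].
  apply: contrapT => L'z.
  (* The complement of [L'] leaves exactly [L'] in [K], and it strictly contains [U] because of
     [z]. *)
  apply: (Umax (~` L')).
    split; last by move=> /(_ z L'z).
    by move=> y Uy /L'U[].
  rewrite /= setDE setCK (_ : K `&` L' = L') //.
  by apply/setIidPr => y /L'U[].
have [->|/set0P[U0 FU0]] := eqVneq F set0.
  by rewrite /= bigcup_set0 setD0.
have cl U : F U -> closed (K `\` U).
  by move=> /FP[_ cU _]; exact: compact_closed.
have DE : K `\` \bigcup_(U in F) U = \bigcap_(U in F) (K `\` U).
  apply/seteqP; split=> [z [Kz nz] U FU|z h].
    by split=> // Uz; apply: nz; exists U.
  by split; [have [] := h _ FU0|move=> [U FU Uz]; have [] := h _ FU].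
rewrite /= DE; split.
(* The remainders of a chain form a proper filter base on [K]; a cluster point lies in each of them,
   as they are closed. *)
- pose B := filter_from F (fun U => K `\` U).
  have PB : ProperFilter B.
    apply: filter_from_proper; last by move=> U /FP[].
    apply: filter_from_filter; first by exists U0.
    move=> U V FU FV; have [UV|VU] := Ftot _ _ FU FV.
      by exists V => // z [Kz Vz]; split; split => // /UV.
    by exists U => // z [Kz Uz]; split; split => // /VU.
  have BK : B K by exists U0 => // z [].
  have [p [Kp clp]] := cK B PB BK.
  exists p => U FU.
  have : closure (K `\` U) p by apply: cluster_sub_closure clp; exists U.
  by move: (cl U FU); rewrite closure_id => <-.
- apply: (subclosed_compact _ cK); last by move=> z /(_ _ FU0)[].
  exact: closed_bigI.
- move=> g Gg _ [z hz <-] U FU; have [_ _ gU] := FP _ FU.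
  by apply: (gU g Gg); exists z => //; exact: hz.
Qed.

(** On the unit ball around each point, the bound n holds for all large n; the near-covering form of
    compactness makes one n serve the whole set. *)
Lemma compact_normc_bounded (R : realType) (A : set (R[i])^o) :
  compact A -> exists M : R, forall z, A z -> normc z <= M.
Proof.
move/compact_near_coveringP/(_ _ \oo (fun n z => normc z <= n%:R) _) => cA.
have : \forall n \near \oo, A `<=` (fun z => normc z <= n%:R).
  apply: cA => z Az.
  exists (ball z 1, [set n : nat | normc z + 1 <= n%:R]).
    split; first exact: nbhsx_ballx.
    exact: nbhs_infty_ger.
  move=> [y n] /= [zy zn]; apply: le_trans zn.
  rewrite -[y](subrK z) addrC; apply: le_trans (le_normcD _ _) _.
  rewrite lerD2l.
  by move: zy; rewrite -ball_normE/= distrC ltcR; exact: ltW.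
by case=> n _ /(_ n (leqnn n)) h; exists n%:R.
Qed.

Lemma complex_continuous (R : realType) :
  continuous (fun p : R * R => (p.1 +i* p.2 : (R[i])^o)).
Proof.
move=> [a b]; apply/cvgrPdist_lt => /= e e0.
(* A positive element of [R[i]] is real. *)
have /andP[/eqP Im_e Re_e] : (complex.Im e == 0) && (0 < complex.Re e).
  by move: e0; rewrite ltcE.
have -> : e = (complex.Re e)%:C.
  by apply/eqP; rewrite eq_complex /= Im_e !eqxx.
have e20 : 0 < complex.Re e / 2 by rewrite divr_gt0.
have ca : (fun p : R * R => p.1) p @[p --> (a, b)] --> a by exact: cvg_fst.
have cb : (fun p : R * R => p.2) p @[p --> (a, b)] --> b by exact: cvg_snd.
move/cvgrPdist_lt : ca => /(_ _ e20) na.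
move/cvgrPdist_lt : cb => /(_ _ e20) nb.
near=> p.
rewrite ltcR.
have -> : (a +i* b) - (p.1 +i* p.2) = (a - p.1)%:C + (0 +i* (b - p.2)) :> R[i].
  by apply/eqP; rewrite eq_complex /= addr0 add0r !eqxx.
apply: le_lt_trans (le_normcD _ _) _.
rewrite normc_real normc_imaginary [ltRHS]splitr; apply: ltrD.
  by near: p.
by near: p.
Unshelve. all: by end_near. Qed.

Lemma closed_disc (R : realType) (M : R) :
  closed [set z : (R[i])^o | normc z <= M].
Proof.
move=> z clz; apply/ler_addgt0Pr => e e0.
have e0C : 0 < e%:C :> R[i] by rewrite ltcR.
have [y [/= yM]] := clz _ (nbhsx_ballx z e%:C e0C).
rewrite -ball_normE/= ltcR => /ltW zy.
rewrite -[z](subrK y) addrC.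
by apply: le_trans (le_normcD _ _) _; rewrite lerD.
Qed.

(** The disc is closed in the continuous image of a compact square. *)
Lemma compact_disc (R : realType) (M : R) :
  compact [set z : (R[i])^o | normc z <= M].
Proof.
have cS : compact (`[- M, M] `*` `[- M, M] : set (R * R)).
  by apply: compact_setX; exact: segment_compact.
have cI := continuous_compact (continuous_subspaceT (@complex_continuous R)) cS.
apply: (subclosed_compact (@closed_disc R M) cI) => -[a b] zM.
exists (a, b) => //; rewrite /= !in_itv/= -!ler_norml; split.
  by apply: le_trans zM; exact: (normc_Re_ge (a +i* b)).
apply: le_trans zM; rewrite /= -sqrtr_sqr ler_sqrt ?lerDr ?sqr_ge0//.
by rewrite addr_ge0 ?sqr_ge0.
Qed.

(** * From the sphere to the plane, and the critical radius *)

Definition quadratics (R : realType) (c : R[i]) (r : R) :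
    ((R[i])^o -> (R[i])^o) -> Prop :=
  fun g => exists2 c', normc (c' - c) <= r & g = fun z => z ^+ 2 + c'.

(** Invariance under the generators passes to compositions by induction on [Gsemi], so planar
    invariant sets can be studied in the plane with the generators alone. *)
Lemma invariant_compact_some (R : realType) (c : R[i]) (r : R)
    (A : set (R[i])^o) :
  invariant_compact (Gsemi c r) (Some @` A) <->
  [/\ A !=set0, compact A & forall g, quadratics c r g -> g @` A `<=` A].
Proof.
split=> [[[_ [a Aa _]] [/compact_image_some cA gA]]|[[a Aa] cA gA]].
  split=> //; first by exists a.
  move=> _ [c' hc' ->] _ [z Az <-].
  have /gA : Gsemi c r (fquad c') by apply: Gsemi_gen; rewrite lecR.
  move=> /(_ (Some (z ^+ 2 + c'))) [|y Ay [<-]//].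
  by exists (Some z) => //; exists z.
split; first by exists (Some a), a.
split; first exact/compact_image_some.
move=> g; elim=> [c' hc'|g1 g2 _ IH1 _ IH2].
  move=> _ [_ [z Az <-] <-]; exists (z ^+ 2 + c') => //.
  apply: (gA (fun z => z ^+ 2 + c')); last by exists z.
  by exists c' => //; rewrite -lecR.
by move=> _ [z Az <-]; apply: IH1; exists (g2 z) => //; apply: IH2; exists z.
Qed.

Lemma image_some_planar (T : Type) (L : set (option T)) :
  ~ L None -> Some @` (Some @^-1` L) = L.
Proof.
move=> LN; apply/seteqP; split=> [_ [z Lz <-] //|[z|] // Lz].
Qed.

Lemma planar_minimal_set_exists (R : realType) (x r : R) :
  0 <= x -> x + r <= 1 / 4 -> exists L, planar_minimal_set (Gsemi x%:C r) L.
Proof.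
move=> x0 xr; pose K : set (R[i])^o := [set z | normc z <= 1 / 2].
have K0 : K !=set0 by exists 0; rewrite /K/mkset Normc.normc0.
have Kinv g : quadratics x%:C r g -> g @` K `<=` K.
  move=> [c hc ->] _ [z Kz <-]; rewrite /K/mkset in Kz *.
  have cE : normc c <= x + r.
    rewrite -[c](subrK x%:C); apply: le_trans (le_normcD _ _) _.
    by rewrite normc_real (ger0_norm x0) addrC lerD2l.
  (* On the disc, |z^2 + c| <= 1/4 + (x + r) <= 1/2. *)
  apply: le_trans (le_normcD _ _) _; rewrite expr2 Normc.normcM.
  by have := normc_ge0 z; nra.
have [L [LK Linv] Lmin] := exists_minimal_invariant_compact
  (@norm_hausdorff _ _) (And3 K0 (@compact_disc R (1 / 2)) Kinv).
exists (Some @` L); split; last by case.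
split; first exact/invariant_compact_some.
move=> L' L'inv L'L.
(* A competitor inside a planar set is planar, so minimality in the plane suffices. *)
have L'N : ~ L' None by move=> /L'L[].
move: L'inv L'L; rewrite -(image_some_planar L'N).
move=> /invariant_compact_some L'inv L'L.
congr (_ @` _); apply: Lmin => // z L'z.
by have [|y Ly [<-]//] := L'L (Some z); exists z.
Qed.

Lemma planar_minimal_set_radius_le (R : realType) (x r : R) L :
  0 <= x <= 1 / 4 -> planar_minimal_set (Gsemi x%:C r) L -> x + r <= 1 / 4.
Proof.
move=> x014 [[Linv _] LN]; rewrite leNgt; apply/negP => xr.
move: Linv; rewrite -(image_some_planar LN).
move=> /invariant_compact_some[[z Lz] cL gL].
have [M LM] := compact_normc_bounded cL.
apply: (bounded_stable_empty (z := z) x014 xr LM) => // y c Ly hc.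
by apply: (gL (fun z => z ^+ 2 + c)); [exists c|exists y].
Qed.

Theorem theorem4p12 (R : realType) (x : R) :
  0 <= x -> x <= 1 / 4 -> rbif (x%:C : R[i]) = 1 / 4 - x.
Proof.
move=> x0 x14.
set E := [set r : R | 0 <= r /\ exists L, planar_minimal_set (Gsemi x%:C r) L].
have Emax : E (1 / 4 - x).
  split; first by rewrite subr_ge0.
  by apply: planar_minimal_set_exists => //; rewrite addrC subrK.
have Eub : ubound E (1 / 4 - x).
  move=> r [_ [L /planar_minimal_set_radius_le]].
  by rewrite x0 x14 => /(_ isT); rewrite lerBrDl.
apply/eqP; rewrite eq_le; apply/andP; split.
  by apply: ge_sup => //; exists (1 / 4 - x).
by apply: ub_le_sup => //; exists (1 / 4 - x).
Qed.
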